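(* Let $X$ and $Y$ be types equipped with operators $\mathrm{int}_X$, $\mathrm{int}_Y$, let $f:X\to Y$ be a function and $s:\mathcal P(X)$. Then $!\,\mathbf{Conti}(f)\multimap\mathbf{Cpt}_X(s)\multimap\mathbf{Cpt}_Y(f(s)).$
   Context: Framework: constructive mathematics with affine logic as internal logic (classical linear logic with weakening but without contraction). Connectives: $\otimes$ (multiplicative conjunction, unit $\top$), $\mathbin{\mathrm{par}}$ (multiplicative disjunction), $\mathbin{\&}$ (additive conjunction), $\oplus$ (additive disjunction), involutive negation $\neg$, $\multimap$ (right associative), exponentials $!,?$; $\forall,\exists$ usual (additive) quantifiers; $\otimes,\mathbin{\&}$ bind tighter than $\mathbin{\mathrm{par}},\oplus,\multimap$. $\Omega$ is the impredicative type of propositions, $\mathcal P(X):=X\to\Omega$, $x\in s$ means $s(x)$, $x\notin s$ means $\neg s(x)$, $s\subseteq t:=\forall x,(x\in s\multimap x\in t)$, $s^{\mathsf c}:=\{x\mid x\notin s\}$, $s\boxtimes t:=\{x\mid x\in s\otimes x\in t\}$, $X$ also denotes $\{x\mid\top\}$. For a type $Z$ with operator $\mathrm{int}$: closure $\mathrm{cl}\,s:=(\mathrm{int}(s^{\mathsf c}))^{\mathsf c}$; filter $\mathbf{Fil}(\mathcal F):=\,!\big((\forall s,t,(s\in\mathcal F\multimap s\subseteq t\multimap t\in\mathcal F))\otimes Z\in\mathcal F\otimes\forall s,t,(s\in\mathcal F\otimes t\in\mathcal F\multimap s\boxtimes t\in\mathcal F)\big)$; compactness $\mathbf{Cpt}_Z(s):=\forall\mathcal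 F:\mathcal P(\mathcal P(Z)),\ \mathbf{Fil}(\mathcal F)\multimap s^{\mathsf c}\notin\mathcal F\multimap\exists z:Z,\big(z\in s\otimes\,!\forall t:\mathcal P(Z),(t\in\mathcal F\multimap z\in\mathrm{cl}\,t)\big)$. For $f:X\to Y$: inverse image $f^{-1}(t):=t\circ f$ for $t:\mathcal P(Y)$; image (impredicative) $f(s):=\{y:Y\mid\forall t:\mathcal P(Y),(s\subseteq f^{-1}(t)\multimap y\in t)\}$ for $s:\mathcal P(X)$; continuity $\mathbf{Conti}(f):=\forall t:\mathcal P(Y),\ f^{-1}(\mathrm{int}_Y t)\subseteq\mathrm{int}_X f^{-1}(t)$. *)

(* Defs.v *)
From Stdlib Require Import List Permutation.

Set Implicit Arguments.
Unset Strict Implicit.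

(* [carrier] is the type Omega of propositions. [all_] and [ex_] accept any type,
   including function types into [carrier] itself: Omega is impredicative.
   Nothing is assumed of the connectives; their meaning is given by [derives]. *)
Record affine_prop : Type := AffineProp {
  carrier :> Type;
  top : carrier;
  neg : carrier -> carrier;
  tensor : carrier -> carrier -> carrier;
  par : carrier -> carrier -> carrier;
  amp : carrier -> carrier -> carrier;
  oplus : carrier -> carrier -> carrier;
  lolli : carrier -> carrier -> carrier;
  ofcourse : carrier -> carrier;
  whynot : carrier -> carrier;
  all_ : forall A : Type, (A -> carrier) -> carrier;
  ex_ : forall A : Type, (A -> carrier) -> carrier
}.

Arguments top {_}.

Declare Scope affine_scope.
Delimit Scope affine_scope with aff.
Bind Scope affine_scope with carrier.

Notation "⊤" := top (at level 0) : affine_scope.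
Notation "¬ p" := (neg p) (at level 37, right associativity) : affine_scope.
Notation "p ⊗ q" := (tensor p q) (at level 40, left associativity) : affine_scope.
Notation "p ⅋ q" := (par p q) (at level 50, left associativity) : affine_scope.
Notation "p ⊕ q" := (oplus p q) (at level 50, left associativity) : affine_scope.
Notation "p ⊸ q" := (lolli p q) (at level 60, right associativity) : affine_scope.
Notation "∀ x .. y , p" := (all_ (fun x => .. (all_ (fun y => p)) ..))
  (at level 200, x binder, y binder, right associativity) : affine_scope.
Notation "∃ x .. y , p" := (ex_ (fun x => .. (ex_ (fun y => p)) ..))
  (at level 200, x binder, y binder, right associativity) : affine_scope.

Local Open Scope affine_scope.

(* Two-sided sequent calculus of classical linear logic with unrestricted
   weakening; contraction is available only for ! on the left and ? on the
   right. Weakening identifies the multiplicative and additive units, so [⊤] is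
   the only unit needed, falsity being [¬ ⊤]. The eigenvariable of a quantifier
   rule is a bound variable of the ambient type theory, whose conversion plays
   the role of beta-eta equality of terms. *)
Inductive derives (L : affine_prop) : list L -> list L -> Prop :=
| d_ax (p : L) : derives (p :: nil) (p :: nil)
| d_cut (p : L) G G' D D' :
    derives G (p :: D) -> derives (p :: G') D' -> derives (G ++ G') (D ++ D')
| d_exchange G G' D D' :
    Permutation G G' -> Permutation D D' -> derives G D -> derives G' D'
| d_weakL (p : L) G D : derives G D -> derives (p :: G) D
| d_weakR (p : L) G D : derives G D -> derives G (p :: D)
| d_topR : derives nil (⊤ :: nil)
| d_negL p G D : derives G (p :: D) -> derives (¬ p :: G) D
| d_negR p G D : derives (p :: G) D -> derives G (¬ p :: D)
| d_tensorL p q G D : derives (p :: q :: G) D -> derives (p ⊗ q :: G) D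
| d_tensorR p q G G' D D' :
    derives G (p :: D) -> derives G' (q :: D') ->
    derives (G ++ G') (p ⊗ q :: D ++ D')
| d_parL p q G G' D D' :
    derives (p :: G) D -> derives (q :: G') D' ->
    derives (p ⅋ q :: G ++ G') (D ++ D')
| d_parR p q G D : derives G (p :: q :: D) -> derives G (p ⅋ q :: D)
| d_lolliL p q G G' D D' :
    derives G (p :: D) -> derives (q :: G') D' ->
    derives ((p ⊸ q) :: G ++ G') (D ++ D')
| d_lolliR p q G D : derives (p :: G) (q :: D) -> derives G ((p ⊸ q) :: D)
| d_ampL1 p q G D : derives (p :: G) D -> derives (amp p q :: G) D
| d_ampL2 p q G D : derives (q :: G) D -> derives (amp p q :: G) D
| d_ampR p q G D :
    derives G (p :: D) -> derives G (q :: D) -> derives G (amp p q :: D)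
| d_plusL p q G D :
    derives (p :: G) D -> derives (q :: G) D -> derives (p ⊕ q :: G) D
| d_plusR1 p q G D : derives G (p :: D) -> derives G (p ⊕ q :: D)
| d_plusR2 p q G D : derives G (q :: D) -> derives G (p ⊕ q :: D)
| d_allL (A : Type) (F : A -> L) (a : A) G D :
    derives (F a :: G) D -> derives (all_ F :: G) D
| d_allR (A : Type) (F : A -> L) G D :
    (forall a : A, derives G (F a :: D)) -> derives G (all_ F :: D)
| d_exL (A : Type) (F : A -> L) G D :
    (forall a : A, derives (F a :: G) D) -> derives (ex_ F :: G) D
| d_exR (A : Type) (F : A -> L) (a : A) G D :
    derives G (F a :: D) -> derives G (ex_ F :: D)
| d_derelictionL p G D : derives (p :: G) D -> derives (ofcourse p :: G) D
| d_contractionL p G D :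
    derives (ofcourse p :: ofcourse p :: G) D -> derives (ofcourse p :: G) D
| d_promotionR p G D :
    derives (map (@ofcourse L) G) (p :: map (@whynot L) D) ->
    derives (map (@ofcourse L) G) (ofcourse p :: map (@whynot L) D)
| d_derelictionR p G D : derives G (p :: D) -> derives G (whynot p :: D)
| d_contractionR p G D :
    derives G (whynot p :: whynot p :: D) -> derives G (whynot p :: D)
| d_promotionL p G D :
    derives (p :: map (@ofcourse L) G) (map (@whynot L) D) ->
    derives (whynot p :: map (@ofcourse L) G) (map (@whynot L) D).

Definition provable (L : affine_prop) (p : L) : Prop := derives nil (p :: nil).

Definition pow (L : affine_prop) (X : Type) : Type := X -> L.

Section Sets.
Variables (L : affine_prop) (X : Type).
Implicit Types s t : pow L X.

Definition mem (x : X) s : L := s x.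
Definition subset s t : L := ∀ x : X, mem x s ⊸ mem x t.
Definition compl s : pow L X := fun x => ¬ mem x s.
Definition boxtimes s t : pow L X := fun x => mem x s ⊗ mem x t.
Definition full : pow L X := fun _ => ⊤.
End Sets.

Arguments full {L X}.

Notation "x ∈ s" := (mem x s) (at level 35, no associativity) : affine_scope.
Notation "x ∉ s" := (¬ mem x s) (at level 35, no associativity) : affine_scope.
Notation "s ⊆ t" := (subset s t) (at level 35, no associativity) : affine_scope.

Section Topology.
Variables (L : affine_prop) (Z : Type).

Definition cl (int : pow L Z -> pow L Z) (s : pow L Z) : pow L Z :=
  compl (int (compl s)).

Definition Fil (F : pow L (pow L Z)) : L :=
  ofcourse ((∀ s t : pow L Z, s ∈ F ⊸ s ⊆ t ⊸ t ∈ F)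
            ⊗ full ∈ F
            ⊗ (∀ s t : pow L Z, s ∈ F ⊗ t ∈ F ⊸ boxtimes s t ∈ F)).

Definition Cpt (int : pow L Z -> pow L Z) (s : pow L Z) : L :=
  ∀ F : pow L (pow L Z), Fil F ⊸ compl s ∉ F ⊸
    ∃ z : Z, z ∈ s ⊗ ofcourse (∀ t : pow L Z, t ∈ F ⊸ z ∈ cl int t).
End Topology.

Section Maps.
Variables (L : affine_prop) (X Y : Type).

Definition preimage (f : X -> Y) (t : pow L Y) : pow L X := fun x => t (f x).

Definition image (f : X -> Y) (s : pow L X) : pow L Y :=
  fun y => ∀ t : pow L Y, s ⊆ preimage f t ⊸ y ∈ t.

Definition Conti (int_X : pow L X -> pow L X) (int_Y : pow L Y -> pow L Y)
    (f : X -> Y) : L :=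
  ∀ t : pow L Y, preimage f (int_Y t) ⊆ int_X (preimage f t).
End Maps.

(* Main.v *)
(* Given a filter [F] on [Y] avoiding the complement of [f(s)], the sets [u] that
   contain some [f^{-1}(v)] with [v] in [F] form a filter on [X]; each use of an
   axiom of [F] is paid for by the exponential in [Fil].  If [f^{-1}(v)] misses
   [s], then by contraposition and the universal property of the image [v] misses
   [f(s)], so the new filter avoids the complement of [s].  Continuity carries an
   adherent point [x] of it to the adherent point [f x] of [F]. *)
From Stdlib Require Import List Permutation.
Require Import Defs.
Import ListNotations.

Set Implicit Arguments.
Unset Strict Implicit.

Local Open Scope affine_scope.

Section DerivedRules.
Variable L : affine_prop.
Implicit Types (p q : L) (G D : list L).

Lemma derives_rotate (n : nat) G D :
  derives (skipn n G ++ firstn n G) D -> derives G D.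
Proof.
  intros H; refine (d_exchange _ (Permutation_refl D) H).
  rewrite <- (firstn_skipn n G) at 3; apply Permutation_app_comm.
Qed.

Lemma derives_hyp p G : derives (p :: G) [p].
Proof.
  apply (@derives_rotate 1); cbn.
  induction G as [|q G IH]; cbn; [apply d_ax | now apply d_weakL].
Qed.

(** Without contraction a hypothesis can be spent only once, so contexts are split by position: the
    first [n] formulas pay for [p], the rest go on. The rules for [⊸] and [⊗] below follow the same
    convention. *)
Lemma derives_cut (n : nat) p G D :
  derives (firstn n G) [p] -> derives (p :: skipn n G) D -> derives G D.
Proof.
  intros Hp HD; rewrite <- (firstn_skipn n G).
  exact (d_cut (D := []) Hp HD).
Qed.

Lemma derives_lolliL (n : nat) p q G D :
  derives (firstn n G) [p] -> derives (q :: skipn n G) D ->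
  derives ((p ⊸ q) :: G) D.
Proof.
  intros Hp HD; rewrite <- (firstn_skipn n G).
  exact (d_lolliL (D := []) Hp HD).
Qed.

Lemma derives_tensorR (n : nat) p q G :
  derives (firstn n G) [p] -> derives (skipn n G) [q] -> derives G [p ⊗ q].
Proof.
  intros Hp Hq; rewrite <- (firstn_skipn n G).
  exact (d_tensorR (D := []) Hp Hq).
Qed.

Lemma derives_contrapositive p q G :
  derives (p :: G) [q] -> derives (¬ q :: G) [¬ p].
Proof.
  intros H; apply d_negR.
  apply (d_exchange (perm_swap p (¬ q) G) (Permutation_refl [])).
  now apply d_negL.
Qed.
End DerivedRules.

Ltac rotate n := apply (@derives_rotate _ n); cbn [skipn firstn app].

(** Moves the head formula to one of five positions, enough for every context reordered below. *)
Ltac permutation :=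
  solve [ reflexivity
        | apply perm_skip; permutation
        | apply (Permutation_cons_app [_]); cbn [app]; permutation
        | apply (Permutation_cons_app [_; _]); cbn [app]; permutation
        | apply (Permutation_cons_app [_; _; _]); cbn [app]; permutation
        | apply (Permutation_cons_app [_; _; _; _]); cbn [app]; permutation ].

Ltac reorder H :=
  refine (@d_exchange _ H _ _ _ _ (Permutation_refl _) _); [permutation|].

Ltac cut_first n p :=
  apply (@derives_cut _ n p); cbn [skipn firstn].

Section Sets.
Variables (L : affine_prop) (X : Type).
Implicit Types s t u : pow L X.

Lemma subset_mem s t (x : X) : derives [s ⊆ t; x ∈ s] [x ∈ t].
Proof.
  apply (d_allL (a := x)).
  apply (@derives_lolliL _ 1); apply derives_hyp.
Qed.

Lemma subset_refl s : derives [] [s ⊆ s].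
Proof. apply d_allR; intros x; apply d_lolliR; apply derives_hyp. Qed.

Lemma subset_trans s t u : derives [s ⊆ t; t ⊆ u] [s ⊆ u].
Proof.
  apply d_allR; intros x; apply d_lolliR.
  reorder [s ⊆ t; x ∈ s; t ⊆ u].
  cut_first 2 (x ∈ t); [apply subset_mem|].
  rotate 1; apply subset_mem.
Qed.

Lemma boxtimes_subset s s' t t' :
  derives [s ⊆ s'; t ⊆ t'] [boxtimes s t ⊆ boxtimes s' t'].
Proof.
  apply d_allR; intros x; apply d_lolliR; apply d_tensorL.
  reorder [s ⊆ s'; x ∈ s; t ⊆ t'; x ∈ t].
  apply (@derives_tensorR _ 2); apply subset_mem.
Qed.
End Sets.

Section Filters.
Variables (L : affine_prop) (Z : Type) (F : pow L (pow L Z)).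
Implicit Types s t : pow L Z.

Lemma Fil_upward s t : derives [Fil F; s ∈ F; s ⊆ t] [t ∈ F].
Proof.
  apply d_derelictionL; do 2 apply d_tensorL.
  apply (d_allL (a := s)), (d_allL (a := t)).
  rotate 1; apply d_weakL; apply d_weakL; rotate 2.
  apply (@derives_lolliL _ 1); [apply derives_hyp|].
  apply (@derives_lolliL _ 1); apply derives_hyp.
Qed.

Lemma Fil_full : derives [Fil F] [full ∈ F].
Proof.
  apply d_derelictionL; do 2 apply d_tensorL.
  apply d_weakL; apply derives_hyp.
Qed.

Lemma Fil_boxtimes s t : derives [Fil F; s ∈ F; t ∈ F] [boxtimes s t ∈ F].
Proof.
  apply d_derelictionL; do 2 apply d_tensorL.
  do 2 apply d_weakL.
  apply (d_allL (a := s)), (d_allL (a := t)).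
  apply (@derives_lolliL _ 2); [|apply derives_hyp].
  apply (@derives_tensorR _ 1); apply derives_hyp.
Qed.
End Filters.

Section Maps.
Variables (L : affine_prop) (X Y : Type) (f : X -> Y).

Definition pullback_filter (F : pow L (pow L Y)) : pow L (pow L X) :=
  fun u => ∃ v : pow L Y, v ∈ F ⊗ preimage f v ⊆ u.

Lemma preimage_mem_pullback_filter (F : pow L (pow L Y)) (v : pow L Y) :
  derives [v ∈ F] [preimage f v ∈ pullback_filter F].
Proof.
  apply (d_exR (a := v)), (@derives_tensorR _ 1); [apply d_ax|].
  apply subset_refl.
Qed.

Lemma Fil_pullback_filter (F : pow L (pow L Y)) :
  derives [Fil F] [Fil (pullback_filter F)].
Proof.
  (* [Fil F] is itself a [!] formula, so promotion keeps it. Contraction then yields one copy for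
     [full] and one for [boxtimes]; upward closure comes from transitivity of inclusion. *)
  apply (d_promotionR (G := [_]) (D := [])); cbn [map].
  apply d_contractionL, (@derives_tensorR _ 1);
    [apply (@derives_tensorR _ 0)|].
  - apply d_allR; intros s; apply d_allR; intros t.
    do 2 apply d_lolliR; rotate 1.
    apply d_exL; intros v; apply d_tensorL.
    apply (d_exR (a := v)), (@derives_tensorR _ 1); [apply d_ax|].
    apply subset_trans.
  (* [preimage f full] is convertible to [full]. *)
  - apply (d_exR (a := full)), (@derives_tensorR _ 1); [apply Fil_full|].
    apply subset_refl.
  - apply d_allR; intros s; apply d_allR; intros t.
    apply d_lolliR; apply d_tensorL.
    apply d_exL; intros v; apply d_tensorL; rotate 2.
    (* [preimage f] commutes with [boxtimes] by conversion. *)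
    apply d_exL; intros w; apply d_tensorL; apply (d_exR (a := boxtimes v w)).
    reorder [Fil F; v ∈ F; w ∈ F; preimage f v ⊆ s; preimage f w ⊆ t].
    apply (@derives_tensorR _ 3); [apply Fil_boxtimes|].
    apply boxtimes_subset.
Qed.

Lemma subset_compl_image (s : pow L X) (v : pow L Y) :
  derives [preimage f v ⊆ compl s] [v ⊆ compl (image f s)].
Proof.
  apply d_allR; intros y; apply d_lolliR; apply d_negR.
  (* The image is tested on [compl v]: the hypothesis, read contrapositively, pays for
     [s ⊆ preimage f (compl v)], and the resulting [y ∈ compl v] contradicts [y ∈ v]. *)
  apply (d_allL (a := compl v)).
  reorder [s ⊆ preimage f (compl v) ⊸ y ∈ compl v; preimage f v ⊆ compl s; y ∈ v].
  apply (@derives_lolliL _ 1); [|apply d_negL, d_ax].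
  apply d_allR; intros x; apply d_lolliR; apply d_negR.
  reorder [preimage f v ⊆ compl s; x ∈ preimage f v; x ∈ s].
  cut_first 2 (x ∈ compl s); [apply subset_mem|].
  apply d_negL, d_ax.
Qed.

Lemma compl_notin_pullback_filter (s : pow L X) (F : pow L (pow L Y)) :
  derives [compl (image f s) ∉ F; Fil F] [compl s ∉ pullback_filter F].
Proof.
  apply derives_contrapositive.
  apply d_exL; intros v; apply d_tensorL.
  reorder [preimage f v ⊆ compl s; v ∈ F; Fil F].
  cut_first 1 (v ⊆ compl (image f s)); [apply subset_compl_image|].
  reorder [Fil F; v ∈ F; v ⊆ compl (image f s)].
  apply Fil_upward.
Qed.

Lemma mem_image (s : pow L X) (x : X) : derives [x ∈ s] [f x ∈ image f s].
Proof.
  apply d_allR; intros t; apply d_lolliR; exact (subset_mem s (preimage f t) x).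
Qed.

(** As closure is dual to interior, this is the contrapositive of continuity at [compl t];
    complement commutes with [preimage f] by conversion. *)
Lemma Conti_cl (int_X : pow L X -> pow L X) (int_Y : pow L Y -> pow L Y)
    (t : pow L Y) (x : X) :
  derives [x ∈ cl int_X (preimage f t); Conti int_X int_Y f] [f x ∈ cl int_Y t].
Proof.
  apply derives_contrapositive; rotate 1.
  apply (d_allL (a := compl t)).
  exact (subset_mem (preimage f (int_Y (compl t))) _ x).
Qed.
End Maps.

Theorem theorem22 (L : affine_prop) (X Y : Type)
    (int_X : pow L X -> pow L X) (int_Y : pow L Y -> pow L Y)
    (f : X -> Y) (s : pow L X) :
  provable (ofcourse (Conti int_X int_Y f) ⊸ Cpt int_X s ⊸ Cpt int_Y (image f s)).
Proof.
  do 2 apply d_lolliR; apply d_allR; intros F; do 2 apply d_lolliR.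
  (* One copy of [Fil F] makes the pullback a filter, the other gives the upward closure used to
     avoid [compl s]. *)
  rotate 1; apply d_contractionL.
  reorder [Cpt int_X s; Fil F; compl (image f s) ∉ F; Fil F;
           ofcourse (Conti int_X int_Y f)].
  apply (d_allL (a := pullback_filter f F)).
  apply (@derives_lolliL _ 1); [apply Fil_pullback_filter|].
  apply (@derives_lolliL _ 2); [apply compl_notin_pullback_filter|].
  apply d_exL; intros x; apply d_tensorL.
  apply (d_exR (a := f x)), (@derives_tensorR _ 1); [apply mem_image|].
  (* With [x ∈ s] spent on the image, only the adherence of [x] and continuity remain. Both are
     under [!], which is what promotion requires. *)
  rotate 1; apply (d_promotionR (G := [_; _]) (D := [])); cbn [map].
  apply d_allR; intros t; apply d_lolliR; rotate 2.
  apply d_derelictionL, (d_allL (a := preimage f t)).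
  apply (@derives_lolliL _ 1); [apply preimage_mem_pullback_filter|].
  rotate 1; apply d_derelictionL; rotate 1.
  apply Conti_cl.
Qed.
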